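(* For every Kripke structure $K$, the Kripke structure $\mathsf{lts}^{-1}(Q)$, where $Q$ is the quotient of the labelled transition system $\mathsf{lts}(K)$ with respect to strong bisimilarity, is isomorphic to the quotient of $K$ with respect to bisimilarity; i.e. $\mathrm{min}^{\leftrightarrow}_{\mathsf{KS}}=\mathsf{lts}^{-1}\circ\mathrm{min}^{\leftrightarrow}_{\mathsf{LTS}}\circ\mathsf{lts}$.
   Context: A Kripke structure is $K=\langle S, AP, \to, L\rangle$ with $S$ a set of states, $AP$ a set of atomic propositions, $\to\,\subseteq S\times S$ a total transition relation, and $L: S\to 2^{AP}$. A labelled transition system (LTS) is $T=\langle S, Act, \to\rangle$ with a special silent action $\tau\notin Act$ and a total transition relation $\to\,\subseteq S\times(Act\cup\{\tau\})\times S$. Write $s\xrightarrow{a}$ if $s\xrightarrow{a}t$ for some $t$. The embedding $\mathsf{lts}$: $\mathsf{lts}(K)=\langle S', Act, \to'\rangle$ where $S' = S\cup\{\bar s \mid s\in S\}$ (fresh copies), $Act = 2^{AP}\cup\{\bot\}$ with $\bot$ fresh, and $\to'$ is the smallest relation with $s\xrightarrow{\bot}\bar s$ and $\bar s\xrightarrow{L(s)} s$ for all $s\in S$, $s\xrightarrow{\tau}t$ whenever $s\to t$ and $L(s)=L(t)$, and $s\xrightarrow{L(t)}t$ whenever $s\to t$ and $L(s)\neq L(t)$. Reversibility: an LTS is reversible iff (1) $Act = 2^{AP}\cup\{\bot\}$ for some $AP$; (2) for $a\neq\bot$, $s\xrightarrow{a}s'$ implies $s'\xrightarrow{\bot}$;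 (3) $s\xrightarrow{\bot}s'$, $s\xrightarrow{\bot}s''$, $s'\xrightarrow{a}$, $s''\xrightarrow{a'}$ imply $a=a'$. For a reversible LTS $T=\langle S,Act,\to\rangle$, $\mathsf{lts}^{-1}(T)=\langle S'',AP,\to'',L''\rangle$ with $S''=\{s\mid s\xrightarrow{\bot}\}$, $Act=2^{AP}\cup\{\bot\}$, $s\to''s'$ iff $s\xrightarrow{a}s'$ for some $a\neq\bot$ and $s\xrightarrow{\bot}$, and $L''(s)$ the unique $a$ with $s\xrightarrow{\bot}s'\xrightarrow{a}$ for some $s'$. Bisimilarity in a Kripke structure: $B$ is a simulation iff for all $(s,s')\in B$, $L(s)=L(s')$ and each $s\to t$ is matched by $s'\to t'$ with $(t,t')\in B$; bisimilar iff some symmetric simulation contains the pair. Strong bisimilarity in an LTS: same without the label condition, each $s\xrightarrow{a}t$ matched by $s'\xrightarrow{a}t'$ with $(t,t')\in B$. Quotients, with $[s]$ the class: bisimilarity quotient of $K$: states the classes, $[s]\to[t]$ iff $s_1\to t_1$ for some $s_1\in[s],t_1\in[t]$, $L([s])=L(s)$; strong bisimilarity quotient of an LTS: states the classes, $[s]\xrightarrow{a}[t]$ iff $s_1\xrightarrow{a}t_1$ for some representatives. $\mathrm{min}$ maps a structure to (a fixed representative of) its quotient; equality is up to isomorphism. *)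

(* Defs.v *)
From mathcomp Require Import all_boot.
From mathcomp Require Import boolp classical_sets.

Set Implicit Arguments.
Unset Strict Implicit.
Unset Printing Implicit Defensive.

Local Open Scope classical_set_scope.

(** Totality of the transition relations is not a field of the records but a
    separate predicate: reversibility alone does not ensure that the transition
    relation of [lts_inv T] is total. *)

Record kripke (AP : Type) := Kripke {
  kstate : Type;
  kstep : kstate -> kstate -> Prop;
  klabel : kstate -> set AP }.
Arguments Kripke {AP} kstate kstep klabel.

Definition kripke_total (AP : Type) (K : kripke AP) : Prop :=
  forall s : kstate K, exists t, kstep s t.

(** [Act] extended with the silent action. *)
Inductive label (Act : Type) := tau | vis (a : Act).
Arguments tau {Act}.
Arguments vis {Act} a.

Record lts (Act : Type) := LTS {
  tstate : Type;
  tstep : tstate -> label Act -> tstate -> Prop }.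
Arguments LTS {Act} tstate tstep.

Definition lts_total (Act : Type) (T : lts Act) : Prop :=
  forall s : tstate T, exists a t, tstep s a t.

Definition enables (Act : Type) (T : lts Act) (s : tstate T) (a : label Act) :
    Prop :=
  exists t, tstep s a t.

(** The set of actions [2^AP] extended with a fresh element. *)
Inductive act (AP : Type) := bot | prop_set (A : set AP).
Arguments bot {AP}.
Arguments prop_set {AP} A.

(** [inl s] stands for the state [s] itself and [inr s] for its fresh copy. *)
Inductive embed_step (AP : Type) (K : kripke AP) :
    kstate K + kstate K -> label (act AP) -> kstate K + kstate K -> Prop :=
| embed_bot s : embed_step (inl s) (vis bot) (inr s)
| embed_label s : embed_step (inr s) (vis (prop_set (klabel s))) (inl s)
| embed_tau s t : kstep s t -> klabel s = klabel t ->
    embed_step (inl s) tau (inl t)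
| embed_vis s t : kstep s t -> klabel s <> klabel t ->
    embed_step (inl s) (vis (prop_set (klabel t))) (inl t).

Definition lts_of (AP : Type) (K : kripke AP) : lts (act AP) :=
  LTS (kstate K + kstate K)%type (@embed_step AP K).

(** The requirement that the set of actions be [2^AP] plus a fresh element is
    expressed by the type of [T]; in both clauses [a] may be silent. *)
Definition reversible (AP : Type) (T : lts (act AP)) : Prop :=
  (forall (s s' : tstate T) a, a <> vis bot -> tstep s a s' ->
     enables s' (vis bot)) /\
  (forall (s s' s'' : tstate T) a a',
     tstep s (vis bot) s' -> tstep s (vis bot) s'' ->
     enables s' a -> enables s'' a' -> a = a').

Definition inv_state (AP : Type) (T : lts (act AP)) : Type :=
  {s : tstate T | enables s (vis bot)}.

Definition inv_label (AP : Type) (T : lts (act AP)) (s : tstate T) (A : set AP) :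
    Prop :=
  exists s', tstep s (vis bot) s' /\ enables s' (vis (prop_set A)).

(** [xget] picks the [A] such that [inv_label s A]; the default value [set0] is
    irrelevant when [lts_inv_defined T]. *)
Definition lts_inv (AP : Type) (T : lts (act AP)) : kripke AP :=
  Kripke (inv_state T)
    (fun s s' => exists a, a <> vis bot /\ tstep (sval s) a (sval s'))
    (fun s => xget set0 [set A | inv_label (sval s) A]).

(** [lts_inv T] is a genuine Kripke structure: each state has a unique label and
    the transition relation is total.  A reversible [T] may violate this, e.g.
    when the only transitions of a state are labelled [bot]. *)
Definition lts_inv_defined (AP : Type) (T : lts (act AP)) : Prop :=
  (forall s : inv_state T, exists! A : set AP, inv_label (sval s) A) /\
  kripke_total (lts_inv T).

Definition kripke_simulation (AP : Type) (K : kripke AP)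
    (B : kstate K -> kstate K -> Prop) : Prop :=
  forall s s', B s s' -> klabel s = klabel s' /\
    (forall t, kstep s t -> exists t', kstep s' t' /\ B t t').

Definition kripke_bisimilar (AP : Type) (K : kripke AP) (s s' : kstate K) : Prop :=
  exists B : kstate K -> kstate K -> Prop,
    (forall x y, B x y -> B y x) /\ kripke_simulation B /\ B s s'.

Definition lts_simulation (Act : Type) (T : lts Act)
    (B : tstate T -> tstate T -> Prop) : Prop :=
  forall s s', B s s' ->
    (forall a t, tstep s a t -> exists t', tstep s' a t' /\ B t t').

Definition lts_bisimilar (Act : Type) (T : lts Act) (s s' : tstate T) : Prop :=
  exists B : tstate T -> tstate T -> Prop,
    (forall x y, B x y -> B y x) /\ lts_simulation B /\ B s s'.

Definition class_of (S : Type) (E : S -> S -> Prop) (s : S) : set S :=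
  [set t | E s t].

Definition classes (S : Type) (E : S -> S -> Prop) : Type :=
  {X : set S | exists s, X = class_of E s}.

Definition to_class (S : Type) (E : S -> S -> Prop) (s : S) : classes E :=
  exist _ (class_of E s) (ex_intro _ s erefl).

Definition class_repr (S : Type) (E : S -> S -> Prop) (X : classes E) : S :=
  sval (cid (svalP X)).

Definition kripke_quotient (AP : Type) (K : kripke AP) : kripke AP :=
  Kripke (classes (@kripke_bisimilar AP K))
    (fun X Y => exists s t, sval X s /\ sval Y t /\ kstep s t)
    (fun X => klabel (class_repr X)).

(** The label of a class does not depend on the representative. *)
Lemma klabel_quotient (AP : Type) (K : kripke AP) (s : kstate K) :
  @klabel AP (kripke_quotient K) (to_class (@kripke_bisimilar AP K) s) = klabel s.
Proof.
rewrite /= /class_repr; case: cid => r /= sr.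
have : class_of (@kripke_bisimilar AP K) r r.
  by exists eq; split=> [x y ->//|]; split=> // x _ <-; split=> // t; exists t.
by rewrite -sr => -[B [_ [simB /simB[]]]].
Qed.

Definition lts_quotient (Act : Type) (T : lts Act) : lts Act :=
  LTS (classes (@lts_bisimilar Act T))
    (fun X a Y => exists s t, sval X s /\ sval Y t /\ tstep s a t).

Definition kripke_iso (AP : Type) (K K' : kripke AP) : Prop :=
  exists f : kstate K -> kstate K',
    bijective f /\
    (forall s t, kstep s t <-> kstep (f s) (f t)) /\
    (forall s, klabel (f s) = klabel s).

(* Main.v *)
(** A state [inl s] of [lts_of K] can move by [bot] whereas a copy [inr s]
    cannot, so strong bisimilarity never identifies the two; and the detour
    through [inr s] makes the label of [s] observable.  Hence [inl s] and [inl t]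
    are strongly bisimilar iff [s] and [t] are bisimilar in [K], and the classes
    that enable [bot] are exactly those of the states [inl s]. *)

Require Import Defs.
From mathcomp Require Import all_boot.
From mathcomp Require Import boolp classical_sets.

Set Implicit Arguments.
Unset Strict Implicit.
Unset Printing Implicit Defensive.

(** * Strong bisimilarity and its quotient *)

Lemma lts_bisimilar_refl (Act : Type) (T : lts Act) (s : tstate T) :
  lts_bisimilar s s.
Proof.
exists eq; split=> [x y -> //|]; split=> // x y -> a t xt; by exists t.
Qed.

Lemma lts_bisimilar_sym (Act : Type) (T : lts Act) (s t : tstate T) :
  lts_bisimilar s t -> lts_bisimilar t s.
Proof. by case=> B [symB [simB /symB]]; exists B. Qed.

Lemma lts_bisimilar_step (Act : Type) (T : lts Act) (s s' t : tstate T) a :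
  lts_bisimilar s s' -> tstep s a t ->
  exists2 t', tstep s' a t' & lts_bisimilar t t'.
Proof.
case=> B [symB [simB Bss']] st.
have [t' [st' Btt']] := simB _ _ Bss' _ _ st.
by exists t' => //; exists B.
Qed.

Lemma lts_bisimilar_trans (Act : Type) (T : lts Act) (s t u : tstate T) :
  lts_bisimilar s t -> lts_bisimilar t u -> lts_bisimilar s u.
Proof.
move=> st tu.
(* Full bisimilarity composed with itself is symmetric; the composite of two arbitrary symmetric
   simulations need not be. *)
exists (fun x z => exists2 y, lts_bisimilar x y & lts_bisimilar y z).
split; [|split].
- by move=> x z [y xy yz]; exists y; apply: lts_bisimilar_sym.
- move=> x z [y xy yz] a x' xx'.
  have [y' yy' xy'] := lts_bisimilar_step xy xx'.
  have [z' zz' yz'] := lts_bisimilar_step yz yy'.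
  by exists z'; split=> //; exists y'.
- by exists t.
Qed.

Lemma lts_class_eq (Act : Type) (T : lts Act) (s t : tstate T) :
  to_class (@lts_bisimilar Act T) s = to_class (@lts_bisimilar Act T) t <->
  lts_bisimilar s t.
Proof.
split=> [/(congr1 sval) /= e|st].
  have : class_of (@lts_bisimilar Act T) t t by exact: lts_bisimilar_refl.
  by rewrite -e.
apply: eq_exist; apply/seteqP; split=> u /=; apply: lts_bisimilar_trans => //.
exact: lts_bisimilar_sym.
Qed.

Lemma classP (S : Type) (E : S -> S -> Prop) (X : classes E) :
  exists s, X = to_class E s.
Proof. by case: X => X [s Xs]; exists s; apply: eq_exist. Qed.

(** The definition of the quotient lets the source representative vary. Bisimilarity carries its
    transition over to any prescribed [s], so moves of a class can be read off at one fixed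
    representative. *)
Lemma lts_quotient_stepP (Act : Type) (T : lts Act) (s : tstate T) a
    (Y : tstate (lts_quotient T)) :
  @tstep _ (lts_quotient T) (to_class (@lts_bisimilar Act T) s) a Y <->
  exists2 t, tstep s a t & Y = to_class (@lts_bisimilar Act T) t.
Proof.
split=> [[s1 [t1 [/= ss1 [Yt1 st1]]]]|[t st ->]]; last first.
  by exists s, t; do !split=> //; exact: lts_bisimilar_refl.
have [t st t1t] := lts_bisimilar_step (lts_bisimilar_sym ss1) st1.
exists t => //; have [y eY] := classP Y; rewrite eY in Yt1 *.
by apply/lts_class_eq/(lts_bisimilar_trans Yt1).
Qed.

Lemma kripke_bisimilar_refl (AP : Type) (K : kripke AP) (s : kstate K) :
  kripke_bisimilar s s.
Proof.
by exists eq; split=> [x y ->//|]; split=> // x _ <-; split=> // t; exists t.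
Qed.

Section Embedding.
Context {AP : Type} (K : kripke AP).
Implicit Types s t : kstate K.

Local Notation T := (lts_of K).
Local Notation Q := (lts_quotient T).
Local Notation cls := (to_class (@lts_bisimilar _ T)).
Local Notation kcls := (to_class (@kripke_bisimilar _ K)).

(** * Transitions and bisimilarity in the embedding *)

Lemma embed_bot_step (x y : tstate T) :
  tstep x (vis bot) y -> exists2 s, x = inl s & y = inr s.
Proof. by move=> xy; inversion xy; exists s. Qed.

Lemma embed_inr_step s a (y : tstate T) :
  @tstep _ T (inr s) a y -> a = vis (prop_set (klabel s)) /\ y = inl s.
Proof. by move=> xy; inversion xy. Qed.

Lemma embed_step_inl (x y : tstate T) a :
  a <> vis bot -> tstep x a y -> exists t, y = inl t.
Proof. by move=> abot xy; inversion xy; subst; eauto. Qed.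

Lemma embed_inl_step s a (y : tstate T) :
  a <> vis bot -> @tstep _ T (inl s) a y -> exists2 t, y = inl t & kstep s t.
Proof. by move=> abot xy; inversion xy; subst; eauto. Qed.

Lemma embed_kstep s t : kstep s t ->
  exists2 a, a <> vis bot & @tstep _ T (inl s) a (inl t).
Proof.
move=> st; have [e|ne] := pselect (klabel s = klabel t).
  by exists tau => //; exact: embed_tau.
by exists (vis (prop_set (klabel t))) => //; exact: embed_vis.
Qed.

(** The move [bot] from [inl s] can only be answered by moving to [inr t], whose sole action carries
    the label of [t]; it must match the label of [s]. *)
Lemma lts_bisimilar_klabel s t :
  @lts_bisimilar _ T (inl s) (inl t) -> klabel s = klabel t.
Proof.
move=> st; have [y /embed_bot_step[_ [<-] ->]] :=
  lts_bisimilar_step st (embed_bot s).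
move=> /lts_bisimilar_step /(_ (embed_label s))[z].
by move=> /embed_inr_step[[]].
Qed.

Lemma embed_bisimilar s t :
  @lts_bisimilar _ T (inl s) (inl t) <-> kripke_bisimilar s t.
Proof.
split=> [st|[B [symB [simB Bst]]]].
  exists (fun x y => @lts_bisimilar _ T (inl x) (inl y)).
  split=> [x y /lts_bisimilar_sym //|]; split=> // x y xy.
  split=> [|x' /embed_kstep[a abot xx']]; first exact: lts_bisimilar_klabel.
  have [z yz] := lts_bisimilar_step xy xx'.
  by have [y' -> yy'] := embed_inl_step abot yz; exists y'.
(* Originals are related to originals and copies to copies, by the same [B]. *)
exists (fun x y => match x, y with
  | inl s, inl t | inr s, inr t => B s t | _, _ => False end).
split=> [[x|x] [y|y]|] //=; try exact: symB.
split=> // -[x|x] [y|y] //= Bxy a z xz; have [lxy stepB] := simB _ _ Bxy.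
- inversion xz; subst.
  + by exists (inr y); split=> //; exact: embed_bot.
  (* Sources and targets related by [B] have equal labels, so the answering step preserves or
     changes the label exactly when the given one does; hence both are silent or both carry the same
     label. *)
  + have [t' [yt' Btt']] := stepB _ H0; have [ltt' _] := simB _ _ Btt'.
    exists (inl t'); split=> //; apply: embed_tau => //; congruence.
  + have [t' [yt' Btt']] := stepB _ H0; have [ltt' _] := simB _ _ Btt'.
    exists (inl t'); split=> //; rewrite ltt'; apply: embed_vis => //; congruence.
- have [-> ->] := embed_inr_step xz.
  by exists (inl y); split=> //; rewrite lxy; exact: embed_label.
Qed.

(** Transitivity of bisimilarity in [K] is imported from strong bisimilarity through
    [embed_bisimilar]. *)
Lemma kripke_class_eq s t : kcls s = kcls t <-> kripke_bisimilar s t.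
Proof.
split=> [/(congr1 sval) /= e|st].
  have : class_of (@kripke_bisimilar _ K) t t by exact: kripke_bisimilar_refl.
  by rewrite -e.
apply: eq_exist; apply/seteqP; split=> u /= /embed_bisimilar.
  move/embed_bisimilar/lts_bisimilar_sym: st => ts su.
  exact/embed_bisimilar/(lts_bisimilar_trans ts).
by move/embed_bisimilar: st => st tu; exact/embed_bisimilar/(lts_bisimilar_trans st).
Qed.

Lemma embed_class_eq s t : cls (inl s) = cls (inl t) <-> kcls s = kcls t.
Proof. by rewrite lts_class_eq embed_bisimilar kripke_class_eq. Qed.

(** * The quotient of the embedding *)

Lemma quotient_bot_step (X Y : tstate Q) : tstep X (vis bot) Y ->
  exists2 s, X = cls (inl s) & Y = cls (inr s).
Proof.
have [x ->] := classP X => /lts_quotient_stepP[y /embed_bot_step[s -> ->] ->].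
by exists s.
Qed.

Lemma quotient_enables_bot s : @enables _ Q (cls (inl s)) (vis bot).
Proof.
by exists (cls (inr s)); apply/lts_quotient_stepP; exists (inr s) => //; exact: embed_bot.
Qed.

Lemma quotient_enables_inr s a :
  @enables _ Q (cls (inr s)) a <-> a = vis (prop_set (klabel s)).
Proof.
split=> [[Y /lts_quotient_stepP[y /embed_inr_step[-> _]]] //|->].
by exists (cls (inl s)); apply/lts_quotient_stepP; exists (inl s) => //; exact: embed_label.
Qed.

(** A [bot]-successor of the class may be the class of [inr t] for another [t], but then [inl s] and
    [inl t] are bisimilar and their labels agree. *)
Lemma quotient_inv_label s A : @inv_label _ Q (cls (inl s)) A <-> A = klabel s.
Proof.
split=> [[Y [/quotient_bot_step[t /lts_class_eq st ->]]]|->].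
  by move/quotient_enables_inr => [->]; rewrite (lts_bisimilar_klabel st).
exists (cls (inr s)); split; last exact/quotient_enables_inr.
by apply/lts_quotient_stepP; exists (inr s) => //; exact: embed_bot.
Qed.

(** The left-hand side is the step relation of [lts_inv Q] freed from the proofs that the states
    enable [bot]. *)
Lemma quotient_kstep s t :
  (exists a, a <> vis bot /\ @tstep _ Q (cls (inl s)) a (cls (inl t))) <->
  @kstep _ (kripke_quotient K) (kcls s) (kcls t).
Proof.
split=> [[a [abot /lts_quotient_stepP[y sy]]]|[s1 [t1 [/= ss1 [tt1 st1]]]]].
  have [u -> su] := embed_inl_step abot sy.
  move=> /embed_class_eq/kripke_class_eq tu.
  by exists s, u; do !split=> //; exact: kripke_bisimilar_refl.
have [a abot st] := embed_kstep st1.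
exists a; split=> //; exists (inl s1), (inl t1).
by do !split=> //; apply/embed_bisimilar.
Qed.

(** * Inverting the embedding on the quotient *)

Lemma inv_stateP (X : inv_state Q) : exists s, sval X = cls (inl s).
Proof. by have [Y /quotient_bot_step[s Xs _]] := svalP X; exists s. Qed.

Lemma quotient_lts_total : lts_total Q.
Proof.
move=> X; have [[s|s] ->] := classP X.
  by exists (vis bot); exact: quotient_enables_bot.
by exists (vis (prop_set (klabel s))); exact/quotient_enables_inr.
Qed.

(** Actions other than [bot] end in classes of originals, which enable [bot]. Two [bot]-successors
    of one class are classes of copies of bisimilar states, so their only actions coincide. *)
Lemma quotient_reversible : reversible Q.
Proof.
split=> [X Y a abot|X Y Z a b].
  have [x ->] := classP X => /lts_quotient_stepP[y /(embed_step_inl abot)[t ->] ->].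
  exact: quotient_enables_bot.
move=> /quotient_bot_step[s -> ->] /quotient_bot_step[t /lts_class_eq st ->].
move=> /quotient_enables_inr -> /quotient_enables_inr ->.
by rewrite (lts_bisimilar_klabel st).
Qed.

Lemma quotient_inv_defined : kripke_total K -> lts_inv_defined Q.
Proof.
move=> totK; split=> X; have [s Xs] := inv_stateP X.
  rewrite Xs; exists (klabel s); split; first exact/quotient_inv_label.
  by move=> A /quotient_inv_label.
have [t st] := totK s.
exists (exist _ (cls (inl t)) (quotient_enables_bot t)) => /=.
rewrite Xs; apply/quotient_kstep; exists s, t.
by do !split=> //; exact: kripke_bisimilar_refl.
Qed.

Lemma quotient_iso : kripke_iso (lts_inv Q) (kripke_quotient K).
Proof.
pose rep (X : inv_state Q) := sval (cid (inv_stateP X)).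
have repE X : sval X = cls (inl (rep X)) by rewrite /rep; case: cid.
(* The choice of [rep] is harmless: by [embed_class_eq], originals in one class of [Q] lie in one
   class of [K]. *)
exists (fun X => kcls (rep X)); split; [|split].
- pose g (Y : classes (@kripke_bisimilar _ K)) : inv_state Q :=
    exist _ (cls (inl (class_repr Y))) (quotient_enables_bot (class_repr Y)).
  have kcls_repr Y : kcls (class_repr Y) = Y.
    rewrite /class_repr; case: cid => /= s.
    by case: Y => Y pY /= Ys; apply: eq_exist.
  exists g => [X|Y].
    have : sval (g (kcls (rep X))) = sval X.
      by rewrite (repE X); apply/embed_class_eq.
    by case: X (g _) => [X pX] [X' pX'] /= XX'; apply: eq_exist.
  by rewrite -[RHS]kcls_repr; apply/embed_class_eq; rewrite -repE.
- by move=> X Y; rewrite -quotient_kstep -!repE.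
- move=> X; rewrite klabel_quotient /=.
  (* The default value of [xget] never arises, since [klabel (rep X)] is a label of [X]. *)
  case: xgetP => [A _ /=|/(_ (klabel (rep X)))].
    by rewrite repE => /quotient_inv_label ->.
  by case; rewrite repE; apply/quotient_inv_label.
Qed.

End Embedding.

Theorem theorem4p9 (AP : Type) (K : kripke AP) (totK : kripke_total K) :
  let Q := lts_quotient (lts_of K) in
  (lts_total Q /\ reversible Q /\ lts_inv_defined Q) /\
  kripke_iso (lts_inv Q) (kripke_quotient K).
Proof.
split; last exact: quotient_iso.
split; first exact: quotient_lts_total.
by split; [exact: quotient_reversible|exact: quotient_inv_defined].
Qed.
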